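(* For an integer $n\ge 0$, $s(n)=n$ if and only if $n\equiv 0\pmod 4$ and $n$ does not belong to any of the sets $Q_r=\{2^{4r}j-4r : j\ge 1\}$, $r=1,2,3,\dots$.
   Context: For integers $m\ge 0$, $k\ge0$ let $\operatorname{bit}_k(m)=\lfloor m/2^k\rfloor\bmod 2$. For $n\ge 0$ the sloping binary number is $s(n)=\sum_{k\ge 0}\operatorname{bit}_k(n+k)2^k$ (the $2^k$ digit of $s(n)$ is the $2^k$ digit of $n+k$). *)

(* Defs.v *)
From mathcomp Require Import all_boot.

Set Implicit Arguments.
Unset Strict Implicit.
Unset Printing Implicit Defensive.

Definition bit (k m : nat) : nat := (m %/ 2 ^ k) %% 2.

(* The series sum_(k >= 0) bit_k(n + k) 2^k, whose terms vanish for k > n since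
   then n + k < 2 ^ k (bit_sloping0); by slopingE every partial sum with more
   than n terms has the same value. *)
Definition sloping (n : nat) : nat := \sum_(k < n.+1) bit k (n + k) * 2 ^ k.

Lemma bit_sloping0 n k : n < k -> bit k (n + k) = 0.
Proof.
move=> lt_nk; rewrite /bit divn_small ?mod0n //.
case: k lt_nk => // k; rewrite ltnS => le_nk.
rewrite expnS mul2n -addnn -addSn.
by apply: leq_add; [apply: leq_ltn_trans le_nk _ |]; apply: ltn_expl.
Qed.

Lemma slopingE n N : n < N -> \sum_(k < N) bit k (n + k) * 2 ^ k = sloping n.
Proof.
elim: N => // N IHN; rewrite ltnS leq_eqVlt => /predU1P[-> // | lt_nN].
by rewrite big_ord_recr /= IHN // bit_sloping0 // addn0.
Qed.

(* Membership of n in Q_r; the subtraction never truncates, as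
   4 r < 2 ^ (4 r) <= 2 ^ (4 r) * j for j >= 1. *)
Definition in_Q (r n : nat) : Prop :=
  exists2 j : nat, 1 <= j & n = 2 ^ (4 * r) * j - 4 * r.

(* Main.v *)
Require Import Defs.
From mathcomp Require Import all_boot zify.

(** Put [a k = (n + k) %% 2 ^ k]. The digit [bit k (n + k) * 2 ^ k] is
    [(n + k) %% 2 ^ k.+1 - a k], and [(n + k) %% 2 ^ k.+1 + 1] is [a k.+1]
    except when [2 ^ k.+1] divides [n + k.+1], where it is [a k.+1 + 2 ^ k.+1].
    The sum telescopes to [sloping n = n + \sum_(k >= 1, 2 ^ k %| n + k) 2 ^ k],
    so [n] is fixed iff no [k >= 1] has [2 ^ k %| n + k]. The cases [k = 1, 2]
    force [4 %| n]; then only multiples [k = 4 * r] can satisfy the divisibility,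
    which is membership in [Q_r]. *)

Lemma modn_bit k m : m %% 2 ^ k.+1 = bit k m * 2 ^ k + m %% 2 ^ k.
Proof.
rewrite /bit [in LHS](divn_eq m (2 ^ k)) [in LHS](divn_eq (m %/ 2 ^ k) 2).
rewrite mulnDl -mulnA -expnS -addnA modnMDl modn_small //.
apply: (@leq_trans (((m %/ 2 ^ k) %% 2).+1 * 2 ^ k)).
  by rewrite mulSn addnC ltn_add2r ltn_pmod // expn_gt0.
by rewrite expnS leq_mul2r ltn_pmod // orbT.
Qed.

Lemma modnS_add m d : 0 < d -> (m %% d).+1 = m.+1 %% d + (d %| m.+1) * d.
Proof.
move=> d_gt0; rewrite modnS; case: ifP => d_m; rewrite ?mul0n ?addn0 //.
rewrite mul1n; apply/eqP; rewrite eqn_leq ltn_pmod //= dvdn_leq //.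
by rewrite /dvdn -addn1 modnDml addn1.
Qed.

(** Adding [N] on the left keeps the telescoping free of subtraction: each unit pays for one step
    from [n + k] to [n + k.+1]. *)
Lemma sum_bit_shift n N :
  \sum_(k < N) bit k (n + k) * 2 ^ k + N =
  (n + N) %% 2 ^ N + \sum_(k < N) (2 ^ k.+1 %| n + k.+1) * 2 ^ k.+1.
Proof.
elim: N => [|N IHN]; first by rewrite !big_ord0 modn1.
rewrite !big_ord_recr /= !addnS addnCA -modnS_add ?expn_gt0 // modn_bit.
by rewrite addnS addnCA [_ + (_ %% _)]addnC -IHN addnA [bit _ _ * _ + _]addnC.
Qed.

Lemma ltn_add_exp2 n k : n < k -> n + k < 2 ^ k.
Proof.
case: k => // k; rewrite ltnS => le_nk; rewrite expnS mul2n -addnn -addSn.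
by apply: leq_add; [apply: leq_ltn_trans le_nk _ |]; apply: ltn_expl.
Qed.

Lemma sloping_dvdE n :
  sloping n = n + \sum_(k < n.+1) (2 ^ k.+1 %| n + k.+1) * 2 ^ k.+1.
Proof.
(* At [N = n.+1] the remainder is [n + N] itself. *)
apply: (@addIn n.+1); rewrite sum_bit_shift modn_small ?ltn_add_exp2 //.
by rewrite addnAC.
Qed.

Lemma sloping_fixP n :
  sloping n = n <-> forall k, 0 < k -> ~~ (2 ^ k %| n + k).
Proof.
rewrite sloping_dvdE; split=> [fix_n [//|k] _|ndvd]; last first.
  by rewrite big1 ?addn0 // => k _; rewrite (negbTE (ndvd _ _)).
(* Beyond the range of the sum divisibility fails, since [0 < n + k.+1 < 2 ^ k.+1]. *)
have [lt_kn|le_nk] := ltnP k n.+1; last first.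
  by rewrite gtnNdvd ?addnS // -addnS ltn_add_exp2 // ltnW.
have /eqP : \sum_(k < n.+1) (2 ^ k.+1 %| n + k.+1) * 2 ^ k.+1 = 0 by lia.
rewrite sum_nat_eq0 => /forallP/(_ (Ordinal lt_kn)) /=.
by rewrite muln_eq0 expn_eq0 eqb0 orbF.
Qed.

Lemma in_QE r n : 0 < r -> in_Q r n <-> 2 ^ (4 * r) %| n + 4 * r.
Proof.
move=> r_gt0; have lt_r := ltn_expl (4 * r) (ltnSn 1).
split=> [[j j_gt0 ->]|/dvdnP[j def_n]].
  rewrite subnK ?dvdn_mulr //.
  by apply: leq_trans (ltnW lt_r) _; rewrite leq_pmulr.
exists j; last by rewrite mulnC -def_n addnK.
by case: j def_n => // /eqP; rewrite mul0n addn_eq0 muln_eq0 -[r == 0]negbK -lt0n r_gt0 andbF.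
Qed.

Theorem theorem5 (n : nat) :
  sloping n = n <->
  (n = 0 %[mod 4] /\ forall r : nat, 1 <= r -> ~ in_Q r n).
Proof.
rewrite sloping_fixP; split=> [ndvd | [n_mod4 notQ] k k_gt0].
  split=> [|r r_gt0 /(in_QE _ _ r_gt0)]; last by apply/negP/ndvd; rewrite muln_gt0.
  by have := ndvd 1 isT; have := ndvd 2 isT; rewrite expn1; lia.
apply/negP=> dvd_nk; have [k1|k_gt1] := leqP k 1.
  by move: dvd_nk; have -> : k = 1; lia.
(* As [4 %| n] too, this makes [k] a multiple of [4]. *)
have dvd4 : 4 %| n + k by apply: dvdn_trans dvd_nk; apply: (@dvdn_exp2l 2 2).
have def_k : k = 4 * (k %/ 4) by lia.
by apply: (notQ (k %/ 4)); first lia; apply/in_QE; [lia | rewrite -def_k].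
Qed.
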